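(* Let $n,k\in\mathbb N$ with $k\ge 5$. Then $$\tilde r(P_k,P_n)\le \frac53 n+12k.$$
   Context: $P_t$ denotes the path on $t$ vertices and $\mathbb N$ the set of positive integers. For finite graphs $G,H$, the game $\tilde R(G,H)$ is played by Builder and Painter on the infinite complete graph $K_{\mathbb N}$ with vertex set $\mathbb N$: in every round Builder chooses a previously unselected edge of $K_{\mathbb N}$ and Painter colours it red or blue. The game ends when there is a red copy of $G$ or a blue copy of $H$ (as a not necessarily induced subgraph) on the board. Builder aims to finish the game as soon as possible, Painter aims to prolong it. The online size Ramsey number $\tilde r(G,H)$ is the number of rounds in $\tilde R(G,H)$ when both players play optimally, i.e. the least $t$ such that Builder has a strategy guaranteeing that the game ends within at most $t$ rounds whatever Painter does. *)

(* Defs.v *)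
From mathcomp Require Import all_boot all_order all_algebra.

Set Implicit Arguments.
Unset Strict Implicit.
Unset Printing Implicit Defensive.

Record fin_graph := FinGraph {
  vertex :> finType;
  adj : rel vertex;
  adj_sym : symmetric adj;
  adj_irrefl : irreflexive adj }.

Definition path_adj (t : nat) : rel 'I_t :=
  fun i j => (i.+1 == j :> nat) || (j.+1 == i :> nat).

Lemma path_adj_sym t : symmetric (@path_adj t).
Proof. by move=> i j; rewrite /path_adj orbC. Qed.

Lemma path_adj_irrefl t : irreflexive (@path_adj t).
Proof. by move=> i; rewrite /path_adj orbb gtn_eqF. Qed.

Definition path_graph (t : nat) : fin_graph :=
  FinGraph (@path_adj_sym t) (@path_adj_irrefl t).

(* The board is the complete graph on the countably infinite set nat; an
   (unordered) edge is encoded by its endpoints in increasing order. *)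
Definition edge := {e : nat * nat | e.1 < e.2}.

Definition joins (e : edge) (u v : nat) : bool :=
  (val e == (u, v)) || (val e == (v, u)).

Definition color := bool.
Definition red : color := true.
Definition blue : color := false.

(* The coloured edges selected so far, in chronological order. *)
Definition board := seq (edge * color).

Definition selected (b : board) : seq edge := [seq m.1 | m <- b].

Definition has_copy (c : color) (G : fin_graph) (b : board) : Prop :=
  exists2 f : G -> nat, injective f &
    forall x y : G, adj x y ->
      exists2 e : edge, (e, c) \in b & joins e (f x) (f y).

Definition game_over (G H : fin_graph) (b : board) : Prop :=
  has_copy red G b \/ has_copy blue H b.

Record builder_strategy := BuilderStrategy {
  choose_edge :> board -> edge;
  choose_edge_new : forall b : board, choose_edge b \notin selected b }.

Definition painter_strategy := board -> edge -> color.

(* The play is continued formally after the game is over; the length of the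
   game is determined by the first round at which game_over holds. *)
Fixpoint play (s : builder_strategy) (p : painter_strategy) (t : nat) : board :=
  if t is t'.+1 then
    let b := play s p t' in rcons b (s b, p b (s b))
  else [::].

Definition builder_wins_within (G H : fin_graph) (t : nat) : Prop :=
  exists s : builder_strategy, forall p : painter_strategy,
    exists2 m : nat, m <= t & game_over G H (play s p m).

Definition is_online_size_ramsey (G H : fin_graph) (r : nat) : Prop :=
  builder_wins_within G H r /\
  forall t : nat, builder_wins_within G H t -> r <= t.

(* Main.v *)
Require Import Defs.
From mathcomp Require Import all_boot all_order all_algebra.
From mathcomp Require Import boolp zify lra.

(* Builder's strategy has three stages; a red path on [k] vertices ends the game
   at any time.  First, Builder joins the end of a red path to new vertices: a
   red answer lengthens the path, and an end with two blue edges leaves it as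
   the middle of a blue path on three vertices.  This yields [N] disjoint blue
   paths on three vertices in [3 N + O(k)] rounds.  Second, these are joined by
   keeping a stack of blue paths whose heads form a red path: the edge from the
   top head to the head of a path off the stack either pushes that path (red) or
   merges it with the popped top (blue).  After [2 N] rounds fewer than [k] blue
   paths are left, still covering [3 N] vertices, that is [5/3] rounds per
   vertex.  Third, these few paths are merged in [O(k)] rounds through the end of
   an auxiliary red path, at the cost of at most [k] vertices. *)

Set Implicit Arguments.
Unset Strict Implicit.
Unset Printing Implicit Defensive.

Import GRing.Theory Num.Theory.

Local Open Scope nat_scope.

(** * Coloured adjacency on a board, and monochromatic paths as lists *)

Definition cadj (c : color) (b : board) : rel nat :=
  fun u v => has (fun m => (m.2 == c) && joins m.1 u v) b.

Lemma cadj_sym c b : symmetric (cadj c b).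
Proof. by move=> u v; apply: eq_has => m; rewrite /joins orbC. Qed.

Lemma cadj_sub c b b' u v : {subset b <= b'} -> cadj c b u v -> cadj c b' u v.
Proof. by move=> sbb' /hasP[m mb mP]; apply/hasP; exists m => //; apply: sbb'. Qed.

Lemma sorted_cadj_sub c b b' p :
  {subset b <= b'} -> sorted (cadj c b) p -> sorted (cadj c b') p.
Proof. by move=> sbb'; apply: sub_sorted => u v; apply: cadj_sub. Qed.

Lemma has_copy_path c b p t :
  uniq p -> sorted (cadj c b) p -> t <= size p -> has_copy c (path_graph t) b.
Proof.
move=> up /(sortedP 0) sp le_tp.
have lt_p (i : 'I_t) : i < size p by apply: leq_trans le_tp.
have step (i j : 'I_t) : i.+1 = j ->
    exists2 e : edge, (e, c) \in b & joins e (nth 0 p i) (nth 0 p j).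
  move=> ij; have := sp i; rewrite ij lt_p => /(_ isT) /hasP[[e c'] eb /=].
  by case/andP=> /eqP <- je; exists e.
exists (fun i : 'I_t => nth 0 p i) => [i j /eqP|i j].
  by rewrite nth_uniq // => /eqP /val_inj.
case/orP=> /eqP /step // [e eb je]; exists e => //.
by move: je; rewrite /joins orbC.
Qed.

Lemma ex_edge u v : u != v -> exists e : edge, joins e u v.
Proof.
rewrite neq_ltn => /orP[] uv.
  by exists (Sub (u, v) uv); rewrite /joins eqxx.
by exists (Sub (v, u) uv); rewrite /joins eqxx orbT.
Qed.

Lemma ex_fresh (s : seq nat) : exists x, x \notin s.
Proof.
exists (\max_(i <- s) i).+1; apply/negP => xs.
by have := @leq_bigmax_seq _ s xpredT id _ xs isT; rewrite ltnn.
Qed.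

Lemma ex_new_edge (b : board) : exists e : edge, e \notin selected b.
Proof.
have [x xs] := ex_fresh (0 :: [seq (val e).2 | e <- selected b]).
have x_gt0 : 0 < x by rewrite lt0n; apply: contraNneq xs => ->; rewrite mem_head.
exists (Sub (0, x) x_gt0); apply: contra xs => eb.
by rewrite inE; apply/orP; right; apply/mapP; exists (Sub (0, x) x_gt0).
Qed.

(** * Backward induction on positions of the game *)

(** Builder's win in at most [t] further rounds from position [b], without strategy objects: the
    stages can then be composed by induction on rounds. *)
Fixpoint forces (G H : fin_graph) (t : nat) (b : board) : Prop :=
  game_over G H b \/
  if t is t'.+1 then
    exists2 e : edge, e \notin selected b &
      forall c, forces G H t' (rcons b (e, c))
  else False.

Lemma forces_over G H t b : game_over G H b -> forces G H t b.
Proof. by case: t => [|t] ob; left. Qed.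

Lemma forces_leq G H t t' b : t <= t' -> forces G H t b -> forces G H t' b.
Proof.
elim: t t' b => [|t IH] [|t'] b //=.
- by move=> _ [|[]]; left.
- move=> le_tt' [|[e eb fb]]; first by left.
  by right; exists e => // c; apply: IH.
Qed.

(* If [uv] has been selected before, its colour is known and no round is spent. *)
Lemma forces_query G H t b u v : u != v ->
  (forall c b', {subset b <= b'} -> cadj c b' u v -> forces G H t b') ->
  forces G H t.+1 b.
Proof.
move=> /ex_edge[e je] fb; case: (boolP (e \in selected b)) => [/mapP[[e' c] eb /= ee']|eb].
  apply: forces_leq (leqnSn t) _; apply: (fb c) => //.
  by apply/hasP; exists (e', c); rewrite //= -ee' je eqxx.
right; exists e => // c; apply: (fb c) => [m mb|]; first by rewrite mem_rcons inE mb orbT.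
by rewrite /cadj has_rcons /= eqxx je.
Qed.

Lemma size_play s p t : size (play s p t) = t.
Proof. by elim: t => //= t IH; rewrite size_rcons IH. Qed.

Lemma forces_builder_wins G H t : forces G H t [::] -> builder_wins_within G H t.
Proof.
move=> ft.
(* The length of the board counts the rounds played, so [t - size b] rounds remain and the choice
   can depend on the board alone. *)
pose good b (e : edge) := e \notin selected b /\
  forall c, forces G H (t - size b).-1 (rcons b (e, c)).
have /choice[s sP] (b : board) : exists e : edge,
    e \notin selected b /\ ((exists e', good b e') -> good b e).
  (* A strategy must be total: on a board without a good edge any new edge serves. *)
  have [[e ge]|nge] := pselect (exists e, good b e).
    by exists e; case: (ge).
  by have [e eb] := ex_new_edge b; exists e; split=> // /nge.
exists (BuilderStrategy (fun b => (sP b).1)) => p.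
set S := BuilderStrategy _.
suff inv i : i <= t -> (exists2 m, m <= t & game_over G H (play S p m)) \/
    forces G H (t - i) (play S p i).
  by case: (inv t (leqnn t)) => //; rewrite subnn => -[|//] ob; exists t.
elim: i => [|i IH] lt_it; first by right; rewrite subn0.
case: (IH (ltnW lt_it)) => [|fi]; first by left.
move: fi; rewrite subnS -(prednK (n := t - i)) ?subn_gt0 //= => -[ob|[e eb fe]].
  by left; exists i => //; apply: ltnW.
right; have [|_ /(_ (p (play S p i) (s (play S p i))))] := (sP (play S p i)).2.
  by exists e; split=> // c; rewrite size_play.
by rewrite size_play.
Qed.

Arguments forces : simpl never.

Lemma ex_online_size_ramsey G H t : builder_wins_within G H t ->
  exists2 r, is_online_size_ramsey G H r & r <= t.
Proof.
move=> wt; have ex : exists r, `[< builder_wins_within G H r >] by exists t; apply/asboolP.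
case: (ex_minnP ex) => r /asboolP wr min_r.
by exists r; [split=> // m wm|]; apply: min_r; apply/asboolP.
Qed.

(** * Families of disjoint blue paths and their joins *)

Lemma sorted_rev_cat (T : Type) (e : rel T) y s z u : symmetric e ->
  sorted e (y :: s) -> e y z -> sorted e (z :: u) ->
  sorted e (rev (y :: s) ++ z :: u).
Proof.
move=> sym_e; rewrite -catrevE /=.
elim: s y z u => [|x s IH] y z u /= => [_ -> //|/andP[yx xs] yz zu].
by apply: IH => //=; rewrite ?yz // sym_e.
Qed.

(** Uniqueness of the concatenation makes each path simple and the paths pairwise disjoint at once.
    Empty lists are allowed. *)
Definition blue_paths (b : board) (F : seq (seq nat)) : bool :=
  uniq (flatten F) && all (sorted (cadj blue b)) F.

Definition heads (F : seq (seq nat)) : seq nat := [seq head 0 p | p <- F].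

Lemma blue_paths_sub b b' F : {subset b <= b'} -> blue_paths b F -> blue_paths b' F.
Proof.
move=> sbb' /andP[uF sF]; rewrite /blue_paths uF.
by apply: sub_all sF => p; apply: sorted_cadj_sub.
Qed.

Lemma blue_paths_perm b F F' : perm_eq F F' -> blue_paths b F = blue_paths b F'.
Proof.
by move=> pF; rewrite /blue_paths (perm_all _ pF) (perm_uniq (perm_flatten pF)).
Qed.

Lemma blue_pathsW b F F' : blue_paths b (F ++ F') -> blue_paths b F'.
Proof.
by rewrite /blue_paths flatten_cat cat_uniq all_cat => /andP[/and3P[_ _ ->] /andP[]].
Qed.

Lemma uniq_heads F : [::] \notin F -> uniq (flatten F) -> uniq (heads F).
Proof.
elim: F => //= -[|x p] F IH //=; rewrite inE /= => nF.
rewrite mem_cat cat_uniq negb_or => /and4P[/andP[_ xF] _ _ uF].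
rewrite IH // andbT; apply: contra xF => /mapP[[|y q] qF]; first by rewrite qF in nF.
by move=> /= ->; apply/flattenP; exists (y :: q); rewrite ?mem_head.
Qed.

Lemma blue_paths_fresh b x F :
  x \notin flatten F -> blue_paths b F -> blue_paths b ([:: x] :: F).
Proof. by rewrite /blue_paths /= => ->. Qed.

(** Both paths are met at their heads, so the first is reversed; the multiset of vertices stays the
    same. *)
Lemma blue_paths_join b y s z u F :
  blue_paths b ((y :: s) :: (z :: u) :: F) -> cadj blue b y z ->
  blue_paths b ((rev (y :: s) ++ z :: u) :: F).
Proof.
case/andP=> uF /= /and3P[ys zu sF] yz; apply/andP; split; last first.
  by rewrite [all _ _]/= sF andbT; apply: sorted_rev_cat => //; apply: cadj_sym.
rewrite -[flatten _]/((rev (y :: s) ++ z :: u) ++ flatten F) -catA.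
rewrite (perm_uniq (_ : perm_eq _ ((y :: s) ++ (z :: u) ++ flatten F))) //.
by rewrite perm_cat2r perm_rev.
Qed.

(** * The three stages of Builder's strategy *)

Lemma wins_red k n t b Q : uniq Q -> sorted (cadj red b) Q -> k <= size Q ->
  forces (path_graph k) (path_graph n) t b.
Proof. by move=> uQ sQ kQ; apply: forces_over; left; apply: has_copy_path kQ. Qed.

Lemma wins_blue k n t b A : uniq A -> sorted (cadj blue b) A -> n <= size A ->
  forces (path_graph k) (path_graph n) t b.
Proof. by move=> uA sA nA; apply: forces_over; right; apply: has_copy_path nA. Qed.

(* Every vertex that leaves the red path has one red and two blue edges, so a
   blue path on three vertices costs three rounds; a vertex still on the red
   path has absorbed at most two. *)
Lemma collect_blue_P3 k n N t : 1 < k ->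
  (forall b L, size L = N -> all (fun p => size p == 3) L -> blue_paths b L ->
     forces (path_graph k) (path_graph n) t b) ->
  forall r b st L, blue_paths b (st ++ L) ->
    all (fun p => 0 < size p <= 2) st -> all (fun p => size p == 3) L ->
    sorted (cadj red b) (heads st) -> size st < k -> size L <= N ->
    3 * (N - size L) + 2 * k <= r + size (flatten st) ->
    forces (path_graph k) (path_graph n) (r + t) b.
Proof.
(* Each round raises [3 * size L + size (flatten st)] by one, and [st] holds fewer than [2 * k]
   vertices; hence [size L] reaches [N] before [r] runs out. *)
move=> k_gt1 cont; elim=> [|r IH] b st L bp st2 L3 sh st_k LN le_r.
all: have stP : size (flatten st) <= 2 * size st
  by elim: (st) st2 => //= p s IHs /andP[/andP[_ p2] /IHs]; rewrite size_cat; lia.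
all: have [NL|NL] := eqVneq (size L) N;
  first by apply: (@forces_leq _ _ t); [lia|apply: (cont _ L) => //; apply: blue_pathsW bp].
  lia.
case: st => [|[|c tl] st] // in bp st2 sh st_k le_r stP *.
  (* A new red path starts at a fresh vertex without a round; the unit of [r] given up is matched by
     the vertex gained. *)
  have [x xL] := ex_fresh (flatten L).
  apply: (@forces_leq _ _ (r + t)); first lia.
  apply: (IH b [:: [:: x]] L) => //=; first exact: blue_paths_fresh.
  by rewrite /= in le_r *; lia.
have [x xF] := ex_fresh (flatten (((c :: tl) :: st) ++ L)).
have xc : c != x by apply: contraNneq xF => <-; rewrite mem_head.
rewrite addSn; apply: (forces_query xc) => col b' sbb' cx.
have {}bp := blue_paths_fresh xF (blue_paths_sub sbb' bp).
have {}sh := sorted_cadj_sub sbb' sh.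
case: col cx => cx.
  have shx : sorted (cadj red b') (heads ([:: x] :: (c :: tl) :: st)).
    by rewrite /= cadj_sym cx.
  have [stk|kst] := ltnP (size st).+2 k.
    by apply: (IH b' ([:: x] :: (c :: tl) :: st) L) => //; rewrite /= in le_r *; lia.
  apply: (wins_red _ _ _ shx); last by rewrite size_map.
  apply: uniq_heads; first by apply: contraTN st2; rewrite inE => /(allP _) h; apply/negP => /h.
  by case/andP: bp; rewrite -cat_cons flatten_cat cat_uniq => /and3P[].
have {}bp : blue_paths b' ((rev (c :: tl) ++ [:: x]) :: st ++ L).
  apply: blue_paths_join cx.
  by rewrite (blue_paths_perm _ (permEl (perm_catCA [:: c :: tl] [:: [:: x]] (st ++ L)))).
(* After its first blue edge [c] remains the end of the red path; after the second it is the middle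
   of [y], [c], [x] and leaves. *)
case: tl => [|y [|]] // in bp st2 sh st_k le_r stP xF *.
  by apply: (IH b' ([:: c; x] :: st) L) => //; rewrite /= in le_r *; lia.
apply: (IH b' st ([:: y; c; x] :: L)) => //.
- by rewrite (blue_paths_perm _ (permEl (perm_catCA st [:: [:: y; c; x]] L))).
- by move: sh => /= /path_sorted.
- by rewrite /= in st_k; lia.
- by rewrite /=; lia.
- by rewrite /= in le_r *; lia.
Qed.

(* The heads of the stacked paths form a red path; joining two paths costs the
   blue edge between them and the red edge that had put the first on the stack. *)
Lemma join_blue_paths k n V t : 1 < k ->
  (forall b F, size F < k -> size (flatten F) = V -> blue_paths b F ->
     forces (path_graph k) (path_graph n) t b) ->
  forall r b st L, blue_paths b (st ++ L) -> [::] \notin st ++ L ->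
    sorted (cadj red b) (heads st) -> size st < k ->
    size (flatten (st ++ L)) = V -> 2 * size L + size st <= r ->
    forces (path_graph k) (path_graph n) (r + t) b.
Proof.
(* The quantity [2 * size L + size st] falls by one per round: red shifts a path from [L] to [st],
   blue removes one from [st]. *)
move=> k_gt1 cont; elim=> [|r IH] b st [|u L] bp nF sh st_k VF le_r; rewrite /= in le_r.
- by apply: (cont _ st); rewrite // -[st]cats0.
- by lia.
- by apply: (@forces_leq _ _ t); [lia|apply: (cont _ st); rewrite // -[st]cats0].
case: st => [|s st] in bp nF sh st_k VF le_r *.
  apply: (@forces_leq _ _ (r + t)); first lia.
  by apply: (IH b [:: u] L) => //=; lia.
have pF : perm_eq ((s :: st) ++ u :: L) (s :: u :: (st ++ L)).
  by rewrite cat_cons perm_cons (perm_catCA st [:: u]).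
case: s u => [|y s] [|z u] // in bp nF sh st_k VF le_r pF *.
  by move: nF; rewrite (perm_mem pF) !inE orbT.
have yz : y != z.
  case/andP: bp; rewrite (perm_uniq (perm_flatten pF)) /= => /andP[ynF _] _.
  by apply: contraNneq ynF => ->; rewrite mem_cat mem_head orbT.
rewrite addSn; apply: (forces_query yz) => col b' sbb' cyz.
have {}bp := blue_paths_sub sbb' bp.
have {}sh := sorted_cadj_sub sbb' sh.
case: col cyz => cyz.
  have shz : sorted (cadj red b') (heads ((z :: u) :: (y :: s) :: st)).
    by rewrite /= cadj_sym cyz.
  have pz : perm_eq (((z :: u) :: (y :: s) :: st) ++ L) (((y :: s) :: st) ++ (z :: u) :: L).
    by rewrite (perm_catCA [:: z :: u] ((y :: s) :: st)).
  have bpz : blue_paths b' (((z :: u) :: (y :: s) :: st) ++ L).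
    by rewrite (blue_paths_perm _ pz).
  have nFz : [::] \notin ((z :: u) :: (y :: s) :: st) ++ L by rewrite (perm_mem pz).
  have [stk|kst] := ltnP (size st).+2 k.
    apply: (IH b' ((z :: u) :: (y :: s) :: st) L) => //; last by rewrite /= in le_r *; lia.
    by rewrite (perm_size (perm_flatten pz)).
  apply: (wins_red _ _ _ shz); last by rewrite size_map.
  apply: uniq_heads; first by move: nFz; rewrite mem_cat negb_or => /andP[].
  by case/andP: bpz; rewrite flatten_cat cat_uniq => /and3P[].
(* The join returns to [L], with the last vertex of [y :: s] as its new head, to face the next path
   on the stack. *)
set w := rev (y :: s) ++ z :: u.
have pw : perm_eq (st ++ w :: L) (w :: (st ++ L)) by rewrite (perm_catCA st [:: w]).
apply: (IH b' st (w :: L)).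
- by rewrite (blue_paths_perm _ pw); apply: blue_paths_join; rewrite -?(blue_paths_perm _ pF).
- move: nF; rewrite (perm_mem pF) (perm_mem pw) !inE !negb_or /= => ->.
  by rewrite andbT eq_sym -size_eq0 size_cat size_rev.
- by move: sh => /= /path_sorted.
- by rewrite /= in st_k; lia.
- rewrite (perm_size (perm_flatten pw)) -VF (perm_size (perm_flatten pF)) /w /=.
  by rewrite !size_cat size_rev /= !size_cat; lia.
- by rewrite /= in le_r *; lia.
Qed.

(* A red answer moves an end of a blue path to the red path [Q]; two blue
   answers join [A] and the next path through the end of [Q].  The invariant on
   the number of vertices survives because that end becomes part of the join. *)
Lemma merge_blue_paths k n m : 1 < k -> forall b Q A F,
  sorted (cadj red b) Q -> blue_paths b (A :: F) ->
  uniq (Q ++ flatten (A :: F)) -> size Q < k ->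
  n + (k - size Q) <= size (flatten (A :: F)) ->
  2 * size F + (k - size Q) <= m ->
  forces (path_graph k) (path_graph n) (2 * m) b.
Proof.
(* A step has at most two queries and lowers [2 * size F + (k - size Q)]. The weight 2 pays for a
   join, which shortens [F] by one but also takes a vertex from [Q]. *)
move=> k_gt1; elim: m => [|m IH] b Q A F sQ bp uQ Q_k V_n le_m; first lia.
have IHw b' Q' A' F' : sorted (cadj red b') Q' -> blue_paths b' (A' :: F') ->
    uniq (Q' ++ flatten (A' :: F')) -> size Q' < k ->
    n + (k - size Q') <= size (flatten (A' :: F')) ->
    2 * size F' + (k - size Q') <= m ->
    forces (path_graph k) (path_graph n) (2 * m.+1) b'.
  by move=> *; apply: (@forces_leq _ _ (2 * m)); [lia|apply: (IH b' Q' A' F')].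
case: F => [|B F] in bp uQ V_n le_m *.
  case/andP: bp; rewrite /= cats0 andbT => uA sA.
  by apply: (wins_blue _ _ uA sA); move: V_n; rewrite /= cats0; lia.
(* A path that has given all its vertices to [Q] is simply dropped. *)
case: A => [|a A] in bp uQ V_n le_m *.
  by apply: (IHw b Q B F) => //; rewrite /= in le_m; lia.
case: B => [|c B] in bp uQ V_n le_m *.
  by apply: (IHw b Q (a :: A) F) => //; rewrite /= in le_m; lia.
case: Q => [|q Q] in sQ uQ Q_k V_n le_m *.
  have [q qF] := ex_fresh (flatten [:: a :: A, c :: B & F]).
  apply: (IHw b [:: q] (a :: A) ((c :: B) :: F)) => //.
  - by rewrite cat1s cons_uniq qF.
  - by move: V_n; rewrite [size [::]]/= [size [:: q]]/=; lia.
  - by rewrite /= in le_m *; lia.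
have [qa qc] : q != a /\ q != c.
  move: uQ => /= /andP[qF _].
  by split; apply: contraNneq qF => ->; rewrite !(mem_cat, inE) eqxx ?orbT.
(* The same vertices regrouped for the three outcomes: [a] moves to the red path, [c] does, or [q]
   moves in front of [c :: B]. *)
have uaQ : uniq ((a :: q :: Q) ++ flatten [:: A, c :: B & F]).
  by rewrite (perm_uniq (permEl (perm_catCA [:: a] (q :: Q) _))).
have ucQ : uniq ((c :: q :: Q) ++ flatten [:: a :: A, B & F]).
  rewrite (perm_uniq (permEl (perm_catCA [:: c] (q :: Q) _))).
  by rewrite -(perm_uniq (perm_cat (perm_refl _) (permEl (perm_catCA (a :: A) [:: c] _)))).
have uqB : uniq (Q ++ flatten [:: a :: A, q :: c :: B & F]).
  rewrite catA (perm_uniq (permEl (perm_catCA (Q ++ a :: A) [:: q] _))).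
  by rewrite -catA.
rewrite mulnS; apply: (forces_query qa) => col b1 sbb1 cqa.
have {}bp := blue_paths_sub sbb1 bp.
have {}sQ := sorted_cadj_sub sbb1 sQ.
case: col cqa => cqa.
  have saQ : sorted (cadj red b1) (a :: q :: Q) by rewrite /= cadj_sym cqa.
  have := uaQ; rewrite cat_uniq => /and3P[uQa _ uF].
  have [Qk|kQ] := ltnP (size Q).+2 k; last by apply: (wins_red _ _ _ saQ kQ).
  apply: (@forces_leq _ _ (2 * m)); first lia.
  apply: (IH b1 (a :: q :: Q) A ((c :: B) :: F)) => //.
  - rewrite /blue_paths uF /=.
    by case/andP: bp => _ /= /andP[/path_sorted -> ->].
  - by move: V_n; rewrite /= !size_cat /=; lia.
  - by rewrite /= in le_m *; lia.
apply: (forces_query qc) => col b2 sbb2 cqc.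
have {}bp := blue_paths_sub sbb2 bp.
have {}sQ := sorted_cadj_sub sbb2 sQ.
have {}cqa := cadj_sub sbb2 cqa.
case: col cqc => cqc.
  have scQ : sorted (cadj red b2) (c :: q :: Q) by rewrite /= cadj_sym cqc.
  have := ucQ; rewrite cat_uniq => /and3P[uQc _ uF].
  have [Qk|kQ] := ltnP (size Q).+2 k; last by apply: (wins_red _ _ _ scQ kQ).
  apply: (IH b2 (c :: q :: Q) (a :: A) (B :: F)) => //.
  - rewrite /blue_paths uF /=.
    by case/andP: bp => _ /= /and3P[-> /path_sorted -> ->].
  - by move: V_n; rewrite /= !size_cat /= !size_cat; lia.
  - by rewrite /= in le_m *; lia.
apply: (IH b2 Q (rev (a :: A) ++ q :: c :: B) F).
- exact: path_sorted sQ.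
- apply: blue_paths_join; last by rewrite cadj_sym.
  move: uqB; rewrite /blue_paths cat_uniq => /and3P[_ _ -> /=].
  by case/andP: bp => _ /= /and3P[-> -> ->]; rewrite cqc.
- rewrite -(perm_uniq (_ : perm_eq (Q ++ flatten [:: a :: A, q :: c :: B & F]) _)) //.
  rewrite perm_cat2l -[flatten _]/((a :: A) ++ (q :: c :: B) ++ flatten F).
  rewrite -[flatten (_ :: F)]/((rev (a :: A) ++ q :: c :: B) ++ flatten F).
  by rewrite -catA perm_cat2r perm_sym perm_rev.
- by rewrite /= in Q_k; lia.
- by move: V_n; rewrite /= !size_cat size_rev /= !size_cat /=; lia.
- by rewrite /= in le_m *; lia.
Qed.

(** The stages take [3 * N + 2 * k], [2 * N] and [6 * k] rounds; the summand [k] in the hypothesis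
    covers the vertices the last stage may lose. *)
Lemma builder_wins_paths k n N : 1 < k -> n + k <= 3 * N ->
  builder_wins_within (path_graph k) (path_graph n) (5 * N + 8 * k).
Proof.
move=> k_gt1 le_N; apply: forces_builder_wins.
(* With [Q] and [A] empty at the start, the measure is [2 * size F + k], which is below [3 * k]. *)
have merge b F : size F < k -> size (flatten F) = 3 * N -> blue_paths b F ->
    forces (path_graph k) (path_graph n) (2 * (3 * k)) b.
  move=> F_k VF bp; apply: (@merge_blue_paths k n _ k_gt1 b [::] [::] F) => //=.
  - by case/andP: bp.
  - by lia.
  - by rewrite VF; lia.
  - by lia.
have join b L : size L = N -> all (fun p => size p == 3) L -> blue_paths b L ->
    forces (path_graph k) (path_graph n) (2 * N + 2 * (3 * k)) b.
  move=> LN L3 bp; apply: (join_blue_paths k_gt1 merge (st := [::]) (L := L)) => //.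
  - by apply: contraTN L3 => nL; apply/allPn; exists [::].
  - exact: ltnW.
  - rewrite /= -LN; elim: L L3 {bp LN} => //= p L IH /andP[/eqP p3 /IH].
    by rewrite size_cat p3; lia.
  - by rewrite LN addn0.
rewrite (_ : 5 * N + 8 * k = 3 * N + 2 * k + (2 * N + 2 * (3 * k))); last lia.
by apply: (collect_blue_P3 k_gt1 join (st := [::]) (L := [::])) => //=; lia.
Qed.

Local Open Scope ring_scope.

Theorem theorem1p2 (n k : nat) (hn : (1 <= n)%N) (hk : (5 <= k)%N) :
  exists2 r : nat, is_online_size_ramsey (path_graph k) (path_graph n) r &
    (r%:R : rat) <= 5%:R / 3%:R * n%:R + 12%:R * k%:R.
Proof.
(* This is [(n + k) / 3] rounded up. *)
pose N := ((n + k + 2) %/ 3)%N.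
have k_gt1 : (1 < k)%N by lia.
have N_ge : (n + k <= 3 * N)%N by rewrite /N; lia.
have N_le : (3 * N <= n + k + 2)%N by rewrite /N; lia.
have [r rP r_le] := ex_online_size_ramsey (builder_wins_paths k_gt1 N_ge).
exists r => //.
(* Here [3 * r <= 5 * (n + k + 2) + 24 * k = 5 * n + 29 * k + 10], and [10 <= 7 * k]. *)
have : ((3 * r)%:R <= (5 * n + 36 * k)%:R :> rat) by rewrite ler_nat; lia.
by rewrite natrD !natrM; lra.
Qed.
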